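(* Let $V$ be a vocabulary and let $\varphi[\vec f^{\,V},\vec g^{\,V}]$ be any formula with two distinguished vectors of function variables $\vec f,\vec g$ for $V$ (any other free variables being held fixed as parameters). Then there is a formula $\varphi^*[\vec f^{\,V},\vec g^{\,V}]$ that defines the relation $[\varphi]^*$: for every $A$-structure $\sigma$, $\sigma\models\varphi^*[\vec f,\vec g]$ iff $[\varphi]^*(\sigma(\vec f),\sigma(\vec g))$ holds.
   Context: Fix a denumerable set $A$ of atoms and a fresh ''undefined'' object $\bot$. A $k$-ary $A$-function is a finite partial function $A^k\rightharpoonup A$, identified with its strict extension to $A\cup\{\bot\}$; nullary ones are elements of $A\cup\{\bot\}$. Variables come with arities $k\ge0$. Terms: $\omega$ (denoting $\bot$) and $f t_1\cdots t_k$ for a $k$-ary variable $f$. Formulas: equations $t\doteq q$, closed under $\neg,\wedge,\vee,\to$ and quantifiers $\forall f,\exists f$ over variables of any arity. An $A$-structure $\sigma$ assigns a $k$-ary $A$-function to each $k$-ary variable; $\sigma\models t\doteq q$ iff the values agree, connectives as usual, and $\forall f^k$/$\exists f^k$ range over all finite $F:A^k\rightharpoonup A$ (atomic quantifiers over all of $A\cup\{\bot\}$). For a vocabulary $V=f_1^{r_1}\dots f_k^{r_k}$, $\vec f^{\,V}$ denotes a vector of variables $f_1\dots f_k$ of arities $r_1,\dots,r_k$. The relation $[\varphi]^*$ on pairs of vectors of $A$-functions (of the arities of $V$) is the reflexive–transitive closure of the relation defined by $\varphi$: it is the least relation such that $[\varphi]^*(\vec F,\vec F)$ for all $\vec F$,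 and if $\varphi[\vec F,\vec G]$ and $[\varphi]^*(\vec G,\vec H)$ then $[\varphi]^*(\vec F,\vec H)$; equivalently, $[\varphi]^*(\vec F,\vec G)$ iff there are $\vec H_0,\dots,\vec H_k$ ($k\ge0$) with $\vec H_0=\vec F$, $\vec H_k=\vec G$ and $\varphi[\vec H_i,\vec H_{i+1}]$ for $i<k$. *)

(* Defs.v *)
From Stdlib Require Export Relation_Operators.
From mathcomp Require Export all_boot.
From mathcomp Require Export finmap.

Set Implicit Arguments.
Unset Strict Implicit.
Unset Printing Implicit Defensive.

(* A variable is a pair (arity, index): denumerably many of each arity. *)
Definition var : eqType := (nat * nat)%type.
Definition arity (v : var) : nat := v.1.

Inductive term : Type :=
| Omega
| App (v : var) (ts : 'I_(arity v) -> term).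

Inductive formula : Type :=
| Eqn (t q : term)
| Neg (p : formula)
| And (p q : formula)
| Or (p q : formula)
| Imp (p q : formula)
| All (v : var) (p : formula)
| Ex (v : var) (p : formula).

Section Semantics.

Variable A : choiceType.

(* Finite partial functions A^k -> A. Since 0.-tuple A is a singleton, a      *)
(* nullary A-function is the same thing as an element of A or "undefined".    *)
Definition Afun (k : nat) : Type := {fmap k.-tuple A -> A}.

(* The undefined object is None. The list pmap id (codom v) of the defined    *)
(* arguments has length k exactly when all k arguments are defined, see the   *)
(* two lemmas below.                                                          *)
Definition strict_app k (F : Afun k) (v : 'I_k -> option A) : option A :=
  if (insub (pmap id (codom v)) : option (k.-tuple A)) is Some a
  then F.[? a]%fmap else None.

Lemma strict_app_defined k (F : Afun k) (v : 'I_k -> option A) (a : k.-tuple A) :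
  (forall i, v i = Some (tnth a i)) -> strict_app F v = F.[? a]%fmap.
Proof.
move=> va; rewrite /strict_app.
have -> : pmap id (codom v) = a.
  rewrite /codom /image_mem (eq_map va) (map_comp Some).
  by rewrite (@map_pK _ _ id Some) // map_tnth_enum.
by rewrite valK.
Qed.

Lemma strict_app_undefined k (F : Afun k) (v : 'I_k -> option A) (i : 'I_k) :
  v i = None -> strict_app F v = None.
Proof.
move=> vi; rewrite /strict_app insubF //; apply/negbTE.
rewrite size_pmap -[X in _ != X](card_ord k) -(size_codom v) -all_count.
by apply/allPn; exists (v i); rewrite ?codom_f // vi.
Qed.

Definition structure : Type := forall v : var, Afun (arity v).

Fixpoint eval (sigma : structure) (t : term) : option A :=
  match t with
  | Omega => None
  | App v ts => strict_app (sigma v) (fun i => eval sigma (ts i))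
  end.

Definition update (sigma : structure) (v : var) (F : Afun (arity v)) :
    structure :=
  dfwith sigma F.

Fixpoint sat (sigma : structure) (p : formula) : Prop :=
  match p with
  | Eqn t q => eval sigma t = eval sigma q
  | Neg p => ~ sat sigma p
  | And p q => sat sigma p /\ sat sigma q
  | Or p q => sat sigma p \/ sat sigma q
  | Imp p q => sat sigma p -> sat sigma q
  | All v p => forall F : Afun (arity v), sat (update sigma F) p
  | Ex v p => exists F : Afun (arity v), sat (update sigma F) p
  end.

End Semantics.

(* A vocabulary is the tuple V of its arities. A vector of variables for V    *)
(* is given by its vector x of indices: its i-th entry is vvar V x i.         *)
Definition vvar n (V : n.-tuple nat) (x : 'I_n -> nat) (i : 'I_n) : var :=
  (tnth V i, x i).

Section Vectors.

Variables (A : choiceType) (n : nat) (V : n.-tuple nat).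

Definition funvec : Type := {dffun forall i : 'I_n, Afun A (tnth V i)}.

Definition values (sigma : structure A) (x : 'I_n -> nat) : funvec :=
  [ffun i => sigma (vvar V x i)].

Definition assign (sigma : structure A) (x : 'I_n -> nat) (F : funvec) :
    structure A :=
  foldr (fun i tau => update tau (v := vvar V x i) (F i)) sigma (enum 'I_n).

(* The relation phi[F, G]; sigma interprets the other free variables of phi. *)
Definition defrel (sigma : structure A) (phi : formula) (f g : 'I_n -> nat)
    (F G : funvec) : Prop :=
  sat (assign (assign sigma f F) g G) phi.

Definition defrel_star (sigma : structure A) (phi : formula)
    (f g : 'I_n -> nat) : funvec -> funvec -> Prop :=
  clos_refl_trans_1n funvec (defrel sigma phi f g).

End Vectors.

(* Main.v *)
(** [phi_star] guesses a finite chain and verifies it. A finite unary [S] links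
    atoms, [a] and [b] are its end points, and the finite function [h_i], of
    arity one more than [f_i], stores at the atom [c] the [i]-th entry
    [h_i(c, -)] of the vector attached to [c]. The vectors at [a] and [b] must be
    [f] and [g], and whenever [S c = d] the vectors at [c] and [d] must satisfy
    [phi]; this is said by requantifying the variables [f] and [g] themselves, so
    that nothing has to be substituted into [phi]. That [b] is reachable from [a]
    is expressed by: every finite [P] containing [a] and closed under [S]
    contains [b]. Quantifying over finite sets suffices because the atoms
    reachable along a finite [S] form a finite set. Conversely, since [A] is
    infinite, every chain can be indexed by distinct atoms. *)

Require Import Defs.
From Stdlib Require Import ClassicalEpsilon.
From mathcomp Require Import zify.

Set Implicit Arguments.
Unset Strict Implicit.
Unset Printing Implicit Defensive.

(** * Index bounds and the coincidence lemma *)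

Fixpoint term_bound (t : term) : nat :=
  match t with
  | Omega => 0
  | App v ts => maxn v.2.+1 (\max_i term_bound (ts i))
  end.

(** Only indices are bounded, whatever the arity, so an index at or above the bound occurs in no
    equation of [p] at any arity. *)
Fixpoint formula_bound (p : formula) : nat :=
  match p with
  | Eqn t q => maxn (term_bound t) (term_bound q)
  | Neg p | All _ p | Ex _ p => formula_bound p
  | And p q | Or p q | Imp p q => maxn (formula_bound p) (formula_bound q)
  end.

Definition cst (k : nat) : term := App (v := (0, k)) (fun _ => Omega).
Definition una (k : nat) (t : term) : term := App (v := (1, k)) (fun _ => t).

Section Definability.

Variable A : choiceType.
Implicit Types (s u : structure A) (P Q : structure A -> Prop).

Lemma strict_app_ext k (F : Afun A k) (v w : 'I_k -> option A) :
  v =1 w -> strict_app F v = strict_app F w.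
Proof. by move=> vw; rewrite /strict_app (eq_codom vw). Qed.

Lemma eval_agree s u t :
  (forall v, v.2 < term_bound t -> s v = u v) -> eval s t = eval u t.
Proof.
elim: t => //= v ts IH su.
rewrite su ?leq_maxl //; apply: strict_app_ext => i; apply: IH => w wi.
apply: su; apply: leq_trans wi _; rewrite leq_max; apply/orP; right.
exact: (leq_bigmax (F := fun i => term_bound (ts i))).
Qed.

Lemma update_same s (v : var) (F : Afun A (arity v)) : update s F v = F.
Proof. exact: (dfwith_in (T := fun v => Afun A (arity v))). Qed.

Lemma update_other s (v w : var) (F : Afun A (arity v)) :
  v != w -> update s F w = s w.
Proof. exact: (dfwith_out (T := fun v => Afun A (arity v))). Qed.

(** The hypothesis covers bound variables as well. Updating both structures by the same function
    preserves it, so the induction passes under quantifiers. *)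
Lemma sat_agree p s u :
  (forall v, v.2 < formula_bound p -> s v = u v) -> sat s p <-> sat u p.
Proof.
have upd v (F : Afun A (arity v)) N s1 u1 :
    (forall w : var, w.2 < N -> s1 w = u1 w) ->
    forall w : var, w.2 < N -> update s1 F w = update u1 F w.
  move=> su w wN; have [<-|vw] := eqVneq v w; first by rewrite !update_same.
  by rewrite !update_other // su.
elim: p s u => /= [t q|p IH|p IHp q IHq|p IHp q IHq|p IHp q IHq|v p IH|v p IH] s u su.
- by rewrite !(@eval_agree s u) // => v vp; apply: su; rewrite leq_max vp ?orbT.
- by rewrite (IH s u).
- by rewrite (IHp s u) ?(IHq s u) // => v vp; apply: su; rewrite leq_max vp ?orbT.
- by rewrite (IHp s u) ?(IHq s u) // => v vp; apply: su; rewrite leq_max vp ?orbT.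
- by rewrite (IHp s u) ?(IHq s u) // => v vp; apply: su; rewrite leq_max vp ?orbT.
- by split=> H F; [rewrite -(IH (update s F))|rewrite (IH _ (update u F))] => //;
    apply: upd.
- by split=> -[F H]; exists F; [rewrite -(IH (update s F))|rewrite (IH _ (update u F))] => //;
    apply: upd.
Qed.

(** * Closure properties of definable predicates, replacing explicit syntax *)

Definition definable P := exists p, forall s, sat s p <-> P s.

Lemma definable_ext P Q : (forall s, P s <-> Q s) -> definable P -> definable Q.
Proof. by move=> PQ [p pP]; exists p => s; rewrite pP. Qed.

Lemma definable_sat p : definable (fun s => sat s p).
Proof. by exists p. Qed.

Lemma definable_defined t : definable (fun s => eval s t <> None).
Proof. by exists (Neg (Eqn t Omega)). Qed.

Lemma definable_and P Q :
  definable P -> definable Q -> definable (fun s => P s /\ Q s).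
Proof. by move=> [p pP] [q qQ]; exists (And p q) => s /=; rewrite pP qQ. Qed.

Lemma definable_imp P Q :
  definable P -> definable Q -> definable (fun s => P s -> Q s).
Proof. by move=> [p pP] [q qQ]; exists (Imp p q) => s /=; rewrite pP qQ. Qed.

Lemma definable_all v P : definable P ->
  definable (fun s => forall F : Afun A (arity v), P (update s F)).
Proof.
by move=> [p pP]; exists (All v p) => s; split=> H F; apply/pP; apply: H.
Qed.

Lemma definable_forall (I : finType) (R : I -> structure A -> Prop) :
  (forall i, definable (R i)) -> definable (fun s => forall i, R i s).
Proof.
move=> dR; apply: (@definable_ext (fun s => forall i, i \in enum I -> R i s)).
  by move=> s; split=> H i; [apply: H; rewrite mem_enum|move=> _].
elim: (enum I) => [|i l IH]; first by exists (Eqn Omega Omega).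
apply: definable_ext (definable_and (dR i) IH) => s; split.
  by move=> [Ri Rl] j; rewrite inE => /predU1P[->|/Rl].
by move=> H; split=> [|j jl]; apply: H; rewrite inE ?eqxx ?jl ?orbT.
Qed.

Definition agree_off (L : seq var) s u := forall v, v \notin L -> u v = s v.

Lemma definable_exists_off L P : definable P ->
  definable (fun s => exists u, agree_off L s u /\ P u).
Proof.
move=> [p pP]; elim: L => [|v L [q qP]].
  (* For the empty list [u] and [s] agree only pointwise; [sat_agree] stands in for functional
     extensionality. *)
  exists p => s; rewrite pP; split=> [Ps|[u [su]]]; first by exists s.
  by rewrite -!pP (@sat_agree p u s) // => v _; apply: su.
exists (Ex v q) => s /=; split=> [[F]|[u [su Pu]]].
  rewrite qP => -[u [su Pu]]; exists u; split=> // w.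
  by rewrite inE negb_or => /andP[wv wL]; rewrite su // update_other // eq_sym.
exists (u v); rewrite qP; exists u; split=> // w wL.
have [<-|vw] := eqVneq v w; first by rewrite update_same.
by rewrite update_other // su // inE negb_or eq_sym vw.
Qed.

Lemma definable_forall_off L P : definable P ->
  definable (fun s => forall u, agree_off L s u -> P u).
Proof.
move=> [p pP]; elim: L => [|v L [q qP]].
  exists p => s; rewrite pP; split=> [Ps u su|H]; last exact: H.
  by rewrite -!pP (@sat_agree p u s) ?pP // => v _; apply: su.
exists (All v q) => s /=; split=> [H u su|H F].
  apply: (iffLR (qP (update s (u v))) (H _)).
  move=> w wL; have [<-|vw] := eqVneq v w; first by rewrite update_same.
  by rewrite update_other // su // inE negb_or eq_sym vw.
apply/qP => u su; apply: H => w; rewrite inE negb_or => /andP[wv wL].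
by rewrite su // update_other // eq_sym.
Qed.

(** * Simultaneous assignments, finite functions and term evaluation *)

Definition assign_on (I : Type) (x : I -> var)
    (F : forall i, Afun A (arity (x i))) s (l : seq I) : structure A :=
  foldr (fun i u => update u (F i)) s l.

Lemma assign_on_in (I : eqType) (x : I -> var)
    (F : forall i, Afun A (arity (x i))) s l i :
  injective x -> i \in l -> assign_on F s l (x i) = F i.
Proof.
move=> xI; elim: l => //= j l IH; rewrite inE.
have [->|ij] /= := eqVneq i j; first by rewrite update_same.
by move=> il; rewrite update_other ?IH // (inj_eq xI) eq_sym.
Qed.

Lemma assign_on_out (I : eqType) (x : I -> var)
    (F : forall i, Afun A (arity (x i))) s l v :
  v \notin map x l -> assign_on F s l v = s v.
Proof.
elim: l => //= i l IH; rewrite inE negb_or => /andP[vi vl].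
by rewrite update_other ?IH // eq_sym.
Qed.

Lemma fmap_of_support (K : choiceType) (T : Type) (q : K -> option T) (l : seq K) :
  (forall x, q x <> None -> x \in l) ->
  exists m : {fmap K -> T}, forall x, m.[? x]%fmap = q x.
Proof.
elim: l q => [|y l IH] q ql.
  by exists [fmap]%fmap => x; rewrite fnd_fmap0; case: (q x) (ql x) => // c /(_ ltac:(by [])).
(* Made undefined at [y], [q] is supported by the tail; its value at [y], if any, is put back
   afterwards. *)
have [x|m mq] := IH (fun x => if x == y then None else q x).
  by case: eqVneq => // xy /ql; rewrite inE (negbTE xy).
case E: (q y) => [c|]; [exists m.[y <- c]%fmap|exists m] => x; rewrite ?fnd_set mq.
  by case: eqVneq => // ->.
by case: eqVneq => // ->.
Qed.

Lemma nullary_exists (o : option A) : exists F : Afun A 0, F.[? [tuple]]%fmap = o.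
Proof.
have [|m mo] := @fmap_of_support (0.-tuple A) A (fun=> o) [:: [tuple]].
  by move=> x _; rewrite (tuple0 x) inE.
by exists m.
Qed.

Lemma eval_cst s k : eval s (cst k) = ((s (0, k) : Afun A 0).[? [tuple]])%fmap.
Proof. by apply: strict_app_defined => -[]. Qed.

Lemma eval_una s k t :
  eval s (una k t) = obind (fun c => (s (1, k) : Afun A 1).[? [tuple c]]%fmap) (eval s t).
Proof.
case E: (eval s t) => [c|] /=.
  by apply: strict_app_defined => i; rewrite (ord1 i) tnth0.
exact: (@strict_app_undefined _ 1 _ _ ord0).
Qed.

(** The tuple [z] is quantified through [r] fresh nullary variables, with indices from [M] on, under
    which a single equation remains. Values leaving some of these variables undefined do no harm:
    both sides are then undefined by strictness. *)
Lemma definable_slice (r k k' : nat) t :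
  definable (fun s => exists c, eval s t = Some c /\ forall z : r.-tuple A,
    (s (r, k) : Afun A r).[? z]%fmap =
    (s (r.+1, k') : Afun A r.+1).[? [tuple of c :: z]]%fmap).
Proof.
pose M := maxn (term_bound t) (maxn k.+1 k'.+1).
pose y (j : 'I_r) : var := (0, M + j).
pose lhs := App (v := (r, k)) (fun j : 'I_r => cst (M + j)).
pose rhs := App (v := (r.+1, k'))
  (fun j : 'I_r.+1 => if unlift ord0 j is Some j' then cst (M + j') else t).
have yI : injective y by move=> i j [/addnI /val_inj].
have offM s u (v : var) : agree_off (map y (enum 'I_r)) s u -> v.2 < M -> u v = s v.
  move=> su vM; apply: su; apply/mapP => -[j _ vj].
  by move: vM; rewrite vj /= ltnNge leq_addr.
apply: definable_ext
  (definable_and (definable_defined t)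
    (definable_forall_off (map y (enum 'I_r)) (definable_sat (Eqn lhs rhs)))) => s.
have offt u : agree_off (map y (enum 'I_r)) s u -> eval u t = eval s t.
  by move=> su; apply: eval_agree => v vt; apply: (offM s) => //; rewrite leq_max vt.
have off1 u : agree_off (map y (enum 'I_r)) s u -> u (r, k) = s (r, k).
  by move=> su; apply: (offM s) => //=; rewrite !leq_max leqnn orbT.
have off2 u : agree_off (map y (enum 'I_r)) s u -> u (r.+1, k') = s (r.+1, k').
  by move=> su; apply: (offM s) => //=; rewrite !leq_max leqnn !orbT.
case: (eval s t) offt => [c|] offt; last by split=> [[]//|[c []//]].
have evals u (z : r.-tuple A) : agree_off (map y (enum 'I_r)) s u ->
    (forall j : 'I_r, eval u (cst (M + j)) = Some (tnth z j)) ->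
    (eval u lhs = (s (r, k) : Afun A r).[? z]%fmap) *
    (eval u rhs = (s (r.+1, k') : Afun A r.+1).[? [tuple of c :: z]]%fmap).
  move=> su uz; split.
    by rewrite -(off1 _ su); apply: strict_app_defined => j; rewrite -uz.
  rewrite -(off2 _ su); apply: strict_app_defined => j.
  case: unliftP => [j'|] -> /=; first by rewrite tnthS -uz.
  by rewrite tnth0; exact: offt.
split=> [[_ H]|[_ [[<-] H]]].
  exists c; split=> // z.
  have /fin_all_exists[F Fz] : forall j : 'I_r, exists F : Afun A (arity (y j)),
    (F : Afun A 0).[? [tuple]]%fmap = Some (tnth z j).
    by move=> j; apply: nullary_exists.
  have su : agree_off (map y (enum 'I_r)) s (assign_on F s (enum 'I_r)).
    by move=> v vy; apply: assign_on_out.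
  have [||<- <-] := evals (assign_on F s (enum 'I_r)) z; [by []| |exact: H].
  by move=> j; rewrite eval_cst -[(0, _)]/(y j) assign_on_in ?mem_enum.
split=> // u su; change (eval u lhs = eval u rhs).
case: (boolP [forall j : 'I_r, isSome (eval u (cst (M + j)))]) => [/forallP al|].
  (* All these values are defined, so the default [c] is never taken. *)
  pose z := [tuple odflt c (eval u (cst (M + j))) | j < r].
  have [||-> ->] := evals u z; [by []| |exact: H].
  by move=> j; rewrite tnth_mktuple; case: (eval _ _) (al j).
rewrite negb_forall => /existsP[j]; case E: (eval _ _) => // _.
have -> : eval u lhs = None by apply: (@strict_app_undefined _ r _ _ j).
symmetry; apply: (@strict_app_undefined _ r.+1 _ _ (lift ord0 j)).
by rewrite liftK.
Qed.

End Definability.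

(** * Chains in the reflexive-transitive closure *)

Lemma clos_refl_trans_1n_rcons (T : Type) (R : T -> T -> Prop) x y z :
  clos_refl_trans_1n T R x y -> R y z -> clos_refl_trans_1n T R x z.
Proof.
elim=> [t tz|t u w tu _ IH /IH]; last exact: rt1n_trans.
by apply: rt1n_trans tz _; apply: rt1n_refl.
Qed.

Lemma clos_refl_trans_1n_chain (T : Type) (R : T -> T -> Prop) x y :
  clos_refl_trans_1n T R x y ->
  exists k (H : nat -> T),
    [/\ H 0 = x, H k = y & forall j, j < k -> R (H j) (H j.+1)].
Proof.
elim=> [t|t u w tu _ [k [H [H0 Hk HR]]]]; first by exists 0, (fun=> t).
exists k.+1, (fun j => if j is j'.+1 then H j' else t); split=> // -[_|j jk].
  by rewrite H0.
exact: HR.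
Qed.

Lemma clos_refl_trans_1n_mono (T : Type) (R R' : T -> T -> Prop) x y :
  (forall x y, R x y -> R' x y) ->
  clos_refl_trans_1n T R x y -> clos_refl_trans_1n T R' x y.
Proof.
move=> RR'; elim=> [t|t u w /RR' tu _]; [exact: rt1n_refl|exact: rt1n_trans].
Qed.

(** * Certificates for reachability: definition, soundness and completeness *)

Section Closure.

Variables (A : choiceType) (n : nat) (V : n.-tuple nat) (f g : 'I_n -> nat).
Hypothesis distinct_fg : uniq (codom (vvar V f) ++ codom (vvar V g)).
Variable phi : formula.
Implicit Types (s u w : structure A).

Let fg := codom (vvar V f) ++ codom (vvar V g).

Lemma injective_vvar_l : injective (vvar V f).
Proof. by move: distinct_fg; rewrite cat_uniq => /and3P[/injectiveP]. Qed.

Lemma injective_vvar_r : injective (vvar V g).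
Proof. by move: distinct_fg; rewrite cat_uniq => /and3P[_ _ /injectiveP]. Qed.

Lemma vvar_l_notin_r i : vvar V f i \notin codom (vvar V g).
Proof.
move: distinct_fg; rewrite cat_uniq => /and3P[_ /hasPn fgN _].
by apply/negP => /fgN; rewrite codom_f.
Qed.

(** Giving [f] and [g] in [s] the values they have in [u] yields a structure that agrees with [u] on
    every variable of [phi]. *)
Lemma sat_defrel s u :
  (forall v, v.2 < formula_bound phi -> v \notin fg -> u v = s v) ->
  sat u phi <-> defrel s phi f g (values V u f) (values V u g).
Proof.
move=> su; apply: sat_agree => v vp; rewrite /assign -![foldr _ _ _]/(assign_on _ _ _).
have [/codomP[i ->]|vg] := boolP (v \in codom (vvar V g)).
  by rewrite assign_on_in ?mem_enum ?ffunE //; apply: injective_vvar_r.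
rewrite assign_on_out //.
have [/codomP[i ->]|vf] := boolP (v \in codom (vvar V f)).
  by rewrite assign_on_in ?mem_enum ?ffunE //; apply: injective_vvar_l.
by rewrite assign_on_out // su // mem_cat negb_or vf.
Qed.

Definition bound := maxn (formula_bound phi) (maxn (\max_i (f i).+1) (\max_i (g i).+1)).
Let N := bound.

Lemma fg_lt_N v : v \in fg -> v.2 < N.
Proof.
rewrite mem_cat => /orP[] /codomP[i ->] /=; rewrite !leq_max.
  by rewrite (leq_bigmax (F := fun i => (f i).+1)) ?orbT.
by rewrite (leq_bigmax (F := fun i => (g i).+1)) ?orbT.
Qed.

(* The indices of the auxiliary variables are at least [N], so they occur
   neither in [phi] nor among [f] and [g]. *)
Let vS : var := (1, N).
Let vP : var := (1, N.+1).
Let va : var := (0, N).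
Let vb : var := (0, N.+1).
Let vx : var := (0, N.+2).
Let h (i : 'I_n) : var := ((tnth V i).+1, N.+2 + i).

(** These variables carry the guessed certificate; [vP] and [vx] are quantified inside its clauses
    instead. *)
Definition aux := [:: vS; va; vb] ++ codom h.

Lemma aux_fresh v : v.2 < N -> v \notin aux.
Proof.
move=> vN; apply/negP; rewrite mem_cat !inE.
by case/orP => [/or3P[]/eqP|/codomP[i]] ev; move: vN; rewrite ev /=; lia.
Qed.

Lemma defrel_agree s u (F G : funvec A V) : (forall v, v.2 < N -> u v = s v) ->
  defrel s phi f g F G <-> defrel u phi f g F G.
Proof.
move=> su; apply: sat_agree => v vp; rewrite /assign -![foldr _ _ _]/(assign_on _ _ _).
have [/codomP[i ->]|vg] := boolP (v \in codom (vvar V g)).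
  by rewrite !assign_on_in ?mem_enum //; apply: injective_vvar_r.
rewrite 2!(assign_on_out _ _ vg).
have [/codomP[i ->]|vf] := boolP (v \in codom (vvar V f)).
  by rewrite !assign_on_in ?mem_enum //; apply: injective_vvar_l.
by rewrite !assign_on_out // su // (leq_trans vp) // leq_maxl.
Qed.

Lemma injective_h : injective h.
Proof. by move=> i j [_ /addnI /val_inj]. Qed.

Definition slice s (F : funvec A V) (c : A) :=
  forall i (z : (tnth V i).-tuple A),
  (F i).[? z]%fmap = (s (h i) : Afun A (tnth V i).+1).[? [tuple of c :: z]]%fmap.

(** This is what glues consecutive links of a chain: the vector reached at an atom is the one from
    which the next step starts. *)
Lemma slice_inj s F G c : slice s F c -> slice s G c -> F = G.
Proof. by move=> sF sG; apply/ffunP => i; apply/fmapP => z; rewrite sF sG. Qed.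

Definition slice_term x t s := exists c, eval s t = Some c /\ slice s (values V s x) c.

Lemma definable_slice_term x t : definable (@slice_term x t).
Proof.
pose R i s := exists c, eval s t = Some c /\ forall z : (tnth V i).-tuple A,
  (s (vvar V x i) : Afun A (tnth V i)).[? z]%fmap =
  (s (h i) : Afun A (tnth V i).+1).[? [tuple of c :: z]]%fmap.
have dR i : definable (R i) by apply: definable_slice.
(* Definedness of [t] is a separate conjunct because the conjunction over [i] is empty when [n] is
   0. *)
apply: definable_ext (definable_and (definable_defined A t) (definable_forall dR)) => s.
split=> [[]|[c [tc sc]]].
  case E: (eval s t) => [c|] // _ H; exists c; split=> // i z.
  by have [c' [+ Hz]] := H i; rewrite E => -[->]; rewrite ffunE Hz.
split=> [|i]; first by rewrite tc.
by exists c; split=> // z; rewrite -sc ffunE.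
Qed.

(** Here [cst N], [cst N.+1] and [cst N.+2] are the atoms a, b and x, while [una N] applies S and
    [una N.+1] applies P. *)
Definition step_at u :=
  eval u (una N (cst N.+2)) <> None ->
  exists w, agree_off fg u w /\
    (slice_term f (cst N.+2) w /\
     slice_term g (una N (cst N.+2)) w /\ sat w phi).

Definition step_clause s := forall X : Afun A (arity vx), step_at (update s X).

(** A finite set of atoms is coded as the domain of a unary function, so membership in P is
    definedness of [una N.+1]. *)
Definition closed_at w :=
  eval w (una N.+1 (cst N.+2)) <> None ->
  eval w (una N (cst N.+2)) <> None ->
  eval w (una N.+1 (una N (cst N.+2))) <> None.

Definition reach_at u :=
  eval u (una N.+1 (cst N)) <> None ->
  (forall X : Afun A (arity vx), closed_at (update u X)) ->
  eval u (una N.+1 (cst N.+1)) <> None.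

Definition reach_clause s := forall P : Afun A (arity vP), reach_at (update s P).

Definition certificate s :=
  slice_term f (cst N) s /\ slice_term g (cst N.+1) s /\
  reach_clause s /\ step_clause s.

Lemma definable_certificate : definable certificate.
Proof.
apply: definable_and; first exact: definable_slice_term.
apply: definable_and; first exact: definable_slice_term.
apply: definable_and; apply: definable_all.
  apply: definable_imp; first exact: definable_defined.
  apply: definable_imp; last exact: definable_defined.
  apply: definable_all; do 2! [apply: definable_imp; first exact: definable_defined].
  exact: definable_defined.
apply: definable_imp; first exact: definable_defined.
apply: definable_exists_off.
do 2! [apply: definable_and; first exact: definable_slice_term].
exact: definable_sat.
Qed.

Let neq_snd (v w : var) : v.2 != w.2 -> v != w.
Proof. by apply: contraNneq => ->. Qed.

(** A defined value of [vx] is an atom [c], and an undefined one falsifies the premises of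
    [closed_at]; so the formal quantifier amounts to one over atoms. *)
Lemma reach_clauseP s ca cb : eval s (cst N) = Some ca -> eval s (cst N.+1) = Some cb ->
  reach_clause s <->
  forall P : Afun A 1, P.[? [tuple ca]]%fmap <> None ->
    (forall c d, P.[? [tuple c]]%fmap <> None ->
      (s vS : Afun A 1).[? [tuple c]]%fmap = Some d -> P.[? [tuple d]]%fmap <> None) ->
    P.[? [tuple cb]]%fmap <> None.
Proof.
rewrite !eval_cst => sa sb.
have vPS : vP != vS by apply: neq_snd; rewrite /=; lia.
have key (P : Afun A 1) :
    (forall X : Afun A (arity vx), closed_at (update (update s (v := vP) P) X)) <->
    (forall c d, P.[? [tuple c]]%fmap <> None ->
      (s vS : Afun A 1).[? [tuple c]]%fmap = Some d -> P.[? [tuple d]]%fmap <> None).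
  pose w (X : Afun A (arity vx)) := update (update s (v := vP) P) X.
  have wx X : w X vx = X by apply: update_same.
  have wP X : w X vP = P by rewrite /w update_other // update_same.
  have wS X : w X vS = s vS by rewrite /w !update_other.
  split=> H.
    move=> c d Pc cd; have [X Xc] := nullary_exists (Some c).
    have := H X; rewrite /closed_at !eval_una eval_cst -!/(w X).
    rewrite -!/vS -!/vP -!/vx wx wP wS Xc /= cd /=.
    exact.
  move=> X; rewrite /closed_at !eval_una eval_cst -!/(w X) -!/vS -!/vP -!/vx wx wP wS.
  case: (fnd _ _) => [c|] //= Pc; case cd: (fnd _ _) => [d|] //= _.
  exact: H Pc cd.
split=> H P.
  move=> Pa /key Pcl; have := H P; rewrite /reach_at !eval_una !eval_cst.
  rewrite -!/va -!/vb -!/vP update_same !update_other //.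
  by rewrite sa sb /=; apply.
rewrite /reach_at !eval_una !eval_cst -!/va -!/vb -!/vP update_same !update_other // sa sb /=.
by move=> Pa /key; apply: H.
Qed.

Lemma step_clauseP s :
  step_clause s <->
  forall c d, (s vS : Afun A 1).[? [tuple c]]%fmap = Some d ->
    exists F G, [/\ slice s F c, slice s G d & defrel s phi f g F G].
Proof.
have NfgN v : N <= v.2 -> v \notin fg by apply: contraTN => /fg_lt_N; rewrite ltnNge.
have hN i : h i \notin fg by apply: NfgN; rewrite /=; lia.
have wE (X : Afun A (arity vx)) w : agree_off fg (update s X) w ->
    [/\ w vx = X, w vS = s vS, forall i, w (h i) = s (h i) &
       forall v, v.2 < N -> v \notin fg -> w v = s v].
  move=> sw; split=> [|||v vN vfg].
  - by rewrite sw ?update_same //; apply: NfgN; rewrite /=; lia.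
  - by rewrite sw ?update_other //; apply: NfgN.
  - by move=> i; rewrite sw ?update_other.
  - by rewrite sw ?update_other //; apply: contraTneq vN => <-; rewrite -leqNgt /=; lia.
have sliceE w F c : (forall i, w (h i) = s (h i)) -> slice w F c <-> slice s F c.
  by move=> wh; split=> H i z; have := H i z; rewrite wh.
have bN : formula_bound phi <= N by rewrite leq_maxl.
split=> H.
  move=> c d cd; have [X Xc] := nullary_exists (Some c).
  have [|w [sw [[c' [+ fc]] [[d' [+ gd]] wphi]]]] := H X.
    rewrite eval_una eval_cst -!/vS -!/vx update_same update_other // Xc /=.
    by rewrite cd.
  have [wx wS wh wN] := wE _ _ sw.
  rewrite eval_una !eval_cst -!/vS -!/vx wx wS Xc /= => -[ec]; rewrite cd => -[ed].
  exists (values V w f), (values V w g); split.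
  - by rewrite ec; apply: (iffLR (sliceE _ _ _ wh)).
  - by rewrite ed; apply: (iffLR (sliceE _ _ _ wh)).
  - apply: (iffLR (sat_defrel _)) wphi => v vp; apply: wN; exact: leq_trans vp bN.
move=> X; rewrite /step_at eval_una eval_cst -!/vS -!/vx update_same update_other //.
case Xc: (fnd _ _) => [c|] //=; case cd: (fnd _ _) => [d|] // _.
have [F [G [Fc Gd FG]]] := H c d cd.
(* Since [f] and [g] are disjoint, the outer assignment does not overwrite [F]. *)
pose w := assign (assign (update s X) f F) g G.
have wg i : w (vvar V g i) = G i.
  by apply: assign_on_in; [apply: injective_vvar_r|rewrite mem_enum].
have wf i : w (vvar V f i) = F i.
  rewrite [LHS]assign_on_out; last exact: vvar_l_notin_r.
  by apply: assign_on_in; [apply: injective_vvar_l|rewrite mem_enum].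
have sw : agree_off fg (update s X) w.
  move=> v; rewrite mem_cat negb_or => /andP[vf vg].
  by rewrite [LHS]assign_on_out // [LHS]assign_on_out.
have vF : values V w f = F by apply/ffunP => i; rewrite ffunE wf.
have vG : values V w g = G by apply/ffunP => i; rewrite ffunE wg.
have [wx wS wh wN] := wE _ _ sw.
exists w; split=> //; split; [|split].
- by exists c; rewrite vF eval_cst -/vx wx; split=> //; apply: (iffRL (sliceE _ _ _ wh)).
- exists d; rewrite vG eval_una eval_cst -/vx -/vS wx wS Xc /=; split=> //.
  exact: (iffRL (sliceE _ _ _ wh)).
- apply: (iffRL (@sat_defrel s w _)); last by rewrite vF vG.
  move=> v vp; apply: wN; exact: leq_trans vp bN.
Qed.

(** The atoms carrying a vector reachable from [f] are closed under S by the step clause. Cut down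
    to [ca] and the range of S they form a finite set, still closed, which must therefore contain
    [cb]. *)
Lemma certificate_sound u : certificate u ->
  defrel_star u phi f g (values V u f) (values V u g).
Proof.
move=> [[ca [ua fa]] [[cb [ub gb]]]] [/(reach_clauseP ua ub) reach /step_clauseP step].
pose S := u vS : Afun A 1.
(* [Q] holds at the stored vectors that a chain from [f] reaches, and is used as
   the test set [P] of the reachability clause. *)
pose Q c := c \in (ca |` codomf S)%fset /\
  exists F, slice u F c /\ defrel_star u phi f g (values V u f) F.
(* Only definedness matters, so [ca] serves as an arbitrary value; membership in [Q] is decided
   classically. *)
pose q (c : 1.-tuple A) :=
  if excluded_middle_informative (Q (thead c)) then Some ca else None.
have [c|P Pq] := @fmap_of_support _ _ q [seq [tuple c] | c <- (ca |` codomf S)%fset].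
  rewrite /q; case: excluded_middle_informative => // -[cS _] _.
  apply/mapP; exists (thead c) => //; apply: val_inj.
  by case/tupleP: c {cS} => c t; rewrite (tuple0 t) theadE.
have PQ c : P.[? [tuple c]]%fmap <> None <-> Q c.
  by rewrite Pq /q theadE; case: excluded_middle_informative; split.
have [||_ [G [Gb]]] := (iffLR (PQ cb)) (reach P _ _).
- by apply/PQ; split; [rewrite !inE eqxx|exists (values V u f); split=> //; apply: rt1n_refl].
- move=> c d /PQ[_ [F [Fc starF]]] cd; apply/PQ; split.
    by rewrite in_fset1U; apply/orP; right; apply/codomfP; exists [tuple c].
  (* The step clause supplies its own source [F'], which equals [F] because both are stored at
     [c]. *)
  have [F' [G [F'c Gd FG]]] := step c d cd.
  exists G; split=> //; apply: clos_refl_trans_1n_rcons starF _.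
  by rewrite (slice_inj Fc F'c).
by rewrite (slice_inj gb Gb).
Qed.

(** The [j]-th vector of the chain is stored at the atom [d j], and S sends [d j] to [d j.+1] for
    [j < k]. *)
Lemma certificate_complete s : (exists e : A -> nat, bijective e) ->
  defrel_star s phi f g (values V s f) (values V s g) ->
  exists u, agree_off aux s u /\ certificate u.
Proof.
move=> [e [d ed de]] star_fg.
have [k [H [H0 Hk HR]]] := clos_refl_trans_1n_chain star_fg.
have [c|S SE] := @fmap_of_support (1.-tuple A) A
    (fun c => if e (thead c) < k then Some (d (e (thead c)).+1) else None)
    [seq [tuple d j] | j <- iota 0 k].
  case: ifP => // ck _; apply/mapP; exists (e (thead c)); first by rewrite mem_iota.
  by apply: val_inj; case/tupleP: c {ck} => c t; rewrite (tuple0 t) theadE /= ed.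
have [Fa Fa0] := nullary_exists (Some (d 0)).
have [Fb Fbk] := nullary_exists (Some (d k)).
have /fin_all_exists[Fh FhE] : forall i, exists Fh : Afun A (arity (h i)),
    forall j (z : (tnth V i).-tuple A), j <= k ->
    (Fh : Afun A (tnth V i).+1).[? [tuple of d j :: z]]%fmap = (H j i).[? z]%fmap.
  move=> i; pose r := tnth V i.
  (* The bound is [e (thead c) <= k], not strict as for [S]: [k] links join [k.+1] vectors. *)
  have [c|Fh FhE] := @fmap_of_support (r.+1.-tuple A) A
    (fun c => if e (thead c) <= k
              then (H (e (thead c)) i).[? [tuple of behead c]]%fmap else None)
    [seq cons_tuple (d j) z | j <- iota 0 k.+1, z <- enum_fset (domf (H j i))].
    case: ifP => // ck; case: fndP => // cH _.
    apply/allpairsPdep; exists (e (thead c)), [tuple of behead c].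
    by split; rewrite ?mem_iota ?ltnS ?ck // ed [LHS]tuple_eta; apply: val_inj.
  exists Fh => j z jk; rewrite FhE theadE de jk; congr (fnd _ _).
  exact: val_inj.
pose u0 := update (update (update s (v := vS) S) (v := va) Fa) (v := vb) Fb.
pose u := assign_on Fh u0 (enum 'I_n).
have u_out v : v \notin codom h -> u v = u0 v by exact: assign_on_out.
have uh i : u (h i) = Fh i.
  by apply: assign_on_in; [apply: injective_h|rewrite mem_enum].
have uS : u vS = S.
  rewrite u_out; last by apply/codomP => -[i] [_ ?]; lia.
  by rewrite /u0 update_other // update_other // update_same.
have ua : eval u (cst N) = Some (d 0).
  rewrite eval_cst -/va u_out; last by apply/codomP => -[i] [].
  rewrite /u0 update_other ?update_same //; apply: neq_snd; rewrite /=; lia.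
have ub : eval u (cst N.+1) = Some (d k).
  rewrite eval_cst -/vb u_out; last by apply/codomP => -[i] [].
  by rewrite /u0 update_same.
have su : agree_off aux s u.
  move=> v; rewrite mem_cat !inE !negb_or => /andP[/and3P[vvS vva vvb] vh].
  by rewrite u_out // /u0 !update_other // eq_sym.
have suN v : v.2 < N -> u v = s v by move=> vN; apply: su; apply: aux_fresh.
have uH j : j <= k -> slice u (H j) (d j).
  by move=> jk i z; rewrite uh FhE.
have uf : values V u f = H 0.
  by rewrite H0; apply/ffunP => i; rewrite !ffunE suN // fg_lt_N // mem_cat codom_f.
have ug : values V u g = H k.
  by rewrite Hk; apply/ffunP => i; rewrite !ffunE suN // fg_lt_N // mem_cat codom_f orbT.
exists u; split=> //; split; first by exists (d 0); rewrite uf; split=> //; apply: uH.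
split; first by exists (d k); rewrite ug; split=> //; apply: uH.
split.
  apply/(reach_clauseP ua ub) => P P0 Pcl.
  (* A closed set containing [d 0] takes in the atoms of the chain one after the other. *)
  suff Pj j : j <= k -> P.[? [tuple d j]]%fmap <> None by exact: Pj.
  elim: j => // j IH jk; apply: Pcl (IH (ltnW jk)) _.
  by rewrite uS SE theadE de jk.
apply/step_clauseP => c c'; rewrite uS SE theadE; case: ifP => // ck [<-].
exists (H (e c)), (H (e c).+1); split.
- by rewrite -{2}[c]ed; apply: uH; apply: ltnW.
- exact: uH.
- by apply: (iffLR (defrel_agree _ _ suN)); apply: HR.
Qed.

End Closure.

Theorem theorem4 (A : choiceType) (denumerableA : exists e : A -> nat, bijective e)
    (n : nat) (V : n.-tuple nat) (f g : 'I_n -> nat)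
    (distinct_fg : uniq (codom (vvar V f) ++ codom (vvar V g)))
    (phi : formula) :
  exists phi_star : formula, forall sigma : structure A,
    sat sigma phi_star <->
    defrel_star sigma phi f g (values V sigma f) (values V sigma g).
Proof.
apply: definable_ext
  (definable_exists_off (aux V f g phi) (definable_certificate A V f g phi)) => s.
split=> [[u [su]]|]; last exact: certificate_complete.
move/(certificate_sound distinct_fg).
(* The chain is obtained in [u]. Since [u] differs from [s] only on fresh variables, the end points
   and the relation are the same in [s]. *)
have suN v : v.2 < bound f g phi -> u v = s v by move=> vN; apply: su; apply: aux_fresh.
have -> : values V u f = values V s f.
  by apply/ffunP => i; rewrite !ffunE suN // (@fg_lt_N n V f g) // mem_cat codom_f.
have -> : values V u g = values V s g.
  by apply/ffunP => i; rewrite !ffunE suN // (@fg_lt_N n V f g) // mem_cat codom_f orbT.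
by apply: clos_refl_trans_1n_mono => F G; apply: (iffRL (defrel_agree distinct_fg F G suN)).
Qed.
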